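(* Let $\mathbf{Q}$ be a quantale, $\mathbf{M}$ and $\mathbf{N}$ left $\mathbf{Q}$-modules, $X$ and $Y$ sets, and $\pi:\mathbf{Q}^X\to\mathbf{M}$, $\pi':\mathbf{Q}^Y\to\mathbf{N}$ surjective homomorphisms. Then for every homomorphism $h:\mathbf{M}\to\mathbf{N}$ there exists $k\in Q^{X\times Y}$ such that $h\circ\pi=\pi'\circ H_k$, where $H_k:Q^X\to Q^Y$ is defined by $H_kf(y)=\bigvee_{x\in X}f(x)\cdot k(x,y)$.
   Context: A quantale is $\mathbf{Q}=\langle Q,\vee,\cdot,\bot,e\rangle$ with $\langle Q,\vee,\bot\rangle$ a complete lattice, $\langle Q,\cdot,e\rangle$ a monoid, and multiplication distributing over arbitrary joins on both sides. A left $\mathbf{Q}$-module is a complete lattice $\langle M,\vee,\bot\rangle$ with an action $\star:Q\times M\to M$ satisfying $(q_1q_2)\star m=q_1\star(q_2\star m)$, $e\star m=m$, and distributing over arbitrary joins in each argument; homomorphisms preserve arbitrary joins and the action. For a set $Z$, $\mathbf{Q}^Z$ is the module of maps $Z\to Q$ with pointwise joins and action $(q\star f)(z)=q\cdot f(z)$. *)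

(* Defs.v *)
From HB Require Import structures.
From mathcomp Require Import all_boot all_order.
From mathcomp Require Import boolp classical_sets functions.

Set Implicit Arguments.
Unset Strict Implicit.
Unset Printing Implicit Defensive.

Local Open Scope classical_set_scope.
Local Open Scope group_scope.

(* The bottom element is csup set0; binary joins, the top element and arbitrary
   meets are likewise determined by csup. *)
HB.mixin Record POrder_isCompleteLattice (d : Order.disp_t) L
    of Order.POrder d L := {
  csup : set L -> L;
  csupP : forall A : set L, isLub A (csup A)
}.

#[short(type="completeLatticeType")]
HB.structure Definition CompleteLattice (d : Order.disp_t) :=
  {L of Order.POrder d L & POrder_isCompleteLattice d L}.

HB.mixin Record CompleteLattice_isQuantale (d : Order.disp_t) Q
    of CompleteLattice d Q & monoid.Monoid Q := {
  qmul_csupr : forall (q : Q) (A : set Q),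
    q * csup A = csup [set q * a | a in A];
  qmul_csupl : forall (A : set Q) (q : Q),
    csup A * q = csup [set a * q | a in A]
}.

#[short(type="quantaleType")]
HB.structure Definition Quantale (d : Order.disp_t) :=
  {Q of CompleteLattice d Q & monoid.Monoid Q & CompleteLattice_isQuantale d Q}.

HB.mixin Record CompleteLattice_isQModule (dQ : Order.disp_t)
    (Q : quantaleType dQ) (d : Order.disp_t) M of CompleteLattice d M := {
  qact : Q -> M -> M;
  qactM : forall (q1 q2 : Q) (m : M), qact (q1 * q2) m = qact q1 (qact q2 m);
  qact1 : forall m : M, qact 1 m = m;
  qact_csupr : forall (q : Q) (A : set M),
    qact q (csup A) = csup [set qact q m | m in A];
  qact_csupl : forall (A : set Q) (m : M),
    qact (csup A) m = csup [set qact q m | q in A]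
}.

#[short(type="qmoduleType")]
HB.structure Definition QModule (dQ : Order.disp_t) (Q : quantaleType dQ)
    (d : Order.disp_t) :=
  {M of CompleteLattice d M & CompleteLattice_isQModule dQ Q d M}.

Record qmodule_hom (dQ : Order.disp_t) (Q : quantaleType dQ)
    (dM : Order.disp_t) (M : qmoduleType Q dM)
    (dN : Order.disp_t) (N : qmoduleType Q dN) (h : M -> N) : Prop := {
  qmodule_hom_csup : forall A : set M, h (csup A) = csup [set h m | m in A];
  qmodule_hom_act : forall (q : Q) (m : M), h (qact q m) = qact q (h m)
}.

(* Functions carry the library's pointwise order, so the joins below are forced;
   this makes Z -> Q the module Q^Z. *)
Section FunCompleteLattice.
Variables (Z : Type) (d : Order.disp_t) (L : completeLatticeType d).

Definition fun_csup (F : set (Z -> L)) : Z -> L :=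
  fun z => csup [set f z | f in F].

Lemma fun_csupP (F : set (Z -> L)) : isLub F (fun_csup F).
Proof.
split=> [f Ff|g ubg]; apply/lefP => z.
  by apply: (csupP [set f z | f in F]).1; exists f.
by apply: (csupP [set f z | f in F]).2 => _ [f Ff <-]; move/lefP: (ubg f Ff).
Qed.

HB.instance Definition _ :=
  POrder_isCompleteLattice.Build _ (Z -> L) fun_csupP.

End FunCompleteLattice.

Section FunQModule.
Variables (Z : Type) (d : Order.disp_t) (Q : quantaleType d).

Definition fun_qact (q : Q) (f : Z -> Q) : Z -> Q := fun z => q * f z.

Lemma fun_qactM (q1 q2 : Q) (f : Z -> Q) :
  fun_qact (q1 * q2) f = fun_qact q1 (fun_qact q2 f).
Proof. by apply/funext => z; rewrite /fun_qact mulgA. Qed.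

Lemma fun_qact1 (f : Z -> Q) : fun_qact 1 f = f.
Proof. by apply/funext => z; rewrite /fun_qact mul1g. Qed.

Lemma fun_qact_csupr (q : Q) (F : set (Z -> Q)) :
  fun_qact q (csup F) = csup [set fun_qact q f | f in F].
Proof.
apply/funext => z; rewrite /fun_qact /csup /= /fun_csup qmul_csupr.
by rewrite !image_comp.
Qed.

Lemma fun_qact_csupl (A : set Q) (f : Z -> Q) :
  fun_qact (csup A) f = csup [set fun_qact q f | q in A].
Proof.
apply/funext => z; rewrite /fun_qact qmul_csupl.
by rewrite [RHS]/csup /= /fun_csup image_comp.
Qed.

HB.instance Definition _ :=
  CompleteLattice_isQModule.Build d Q _ (Z -> Q)
    fun_qactM fun_qact1 fun_qact_csupr fun_qact_csupl.

End FunQModule.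

Definition kernel_map (d : Order.disp_t) (Q : quantaleType d) (X Y : Type)
    (k : X * Y -> Q) (f : X -> Q) : Y -> Q :=
  fun y => csup [set f x * k (x, y) | x in [set: X]].

(* Main.v *)
Require Import Defs.
From HB Require Import structures.
From mathcomp Require Import all_boot all_order.
From mathcomp Require Import boolp classical_sets functions.

(** [Q^X] is free on the point masses [qdelta x]: every [f] is the join of the
    [f x * qdelta x], and every map from [X] to a module extends to a
    homomorphism on [Q^X].  Freeness gives projectivity, so [h \o pi] factors
    through [pi'] by a homomorphism [g : Q^X -> Q^Y]; as [g] is determined by
    its values at the point masses, it is [H_k] for
    [k (x, y) = g (qdelta x) y]. *)

Local Open Scope classical_set_scope.

Section CompleteLatticeTheory.
Context {d : Order.disp_t} {L : completeLatticeType d}.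

Lemma csup_eq {A : set L} {s : L} : isLub A s -> csup A = s.
Proof. exact: is_subset1_supremums (csupP A). Qed.

Lemma csup0_le (s : L) : (csup set0 <= s)%O.
Proof. exact: (csupP set0).2. Qed.

Lemma csup_image_csup {I J : Type} (F : I -> J -> L) (A : set I) (B : set J) :
  csup [set csup [set F i j | j in B] | i in A] =
  csup [set F i j | i in A & j in B].
Proof.
have [ubF leF] := csupP [set F i j | i in A & j in B].
apply: csup_eq; split=> [_ [i Ai <-]|u ubu].
- apply: (csupP _).2 => _ [j Bj <-].
  by apply: ubF; exists i => //; exists j.
- apply: leF => _ [i Ai [j Bj <-]].
  apply: Order.le_trans (ubu _ _); last by exists i.
  by apply: (csupP _).1; exists j.
Qed.

Lemma exchange_csup {I J : Type} (F : I -> J -> L) (A : set I) (B : set J) :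
  csup [set csup [set F i j | j in B] | i in A] =
  csup [set csup [set F i j | i in A] | j in B].
Proof.
rewrite !csup_image_csup; congr csup.
by apply/seteqP; split=> _ [a Aa [b Bb <-]]; exists b => //; exists a.
Qed.

Lemma csup_funE {Z : Type} (F : set (Z -> L)) (z : Z) :
  csup F z = csup [set f z | f in F].
Proof. by []. Qed.

End CompleteLatticeTheory.

Section QuantaleTheory.
Context {d : Order.disp_t} {Q : quantaleType d}.

Lemma qmul_csup0 (q : Q) : (q * csup set0)%g = csup set0.
Proof. by rewrite qmul_csupr image_set0. Qed.

Lemma qact_funE {Z : Type} (q : Q) (f : Z -> Q) (z : Z) :
  qact q f z = (q * f z)%g.
Proof. by []. Qed.

End QuantaleTheory.

Lemma qmodule_hom_comp {dQ dM dN dP : Order.disp_t} {Q : quantaleType dQ}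
    {M : qmoduleType Q dM} {N : qmoduleType Q dN} {P : qmoduleType Q dP}
    {g : M -> N} {h : N -> P} :
  qmodule_hom g -> qmodule_hom h -> qmodule_hom (h \o g).
Proof.
move=> [g_csup g_act] [h_csup h_act]; split=> [A|q m] /=.
- by rewrite g_csup h_csup image_comp.
- by rewrite g_act h_act.
Qed.

Definition qcomb {dQ dM : Order.disp_t} {Q : quantaleType dQ}
    {M : qmoduleType Q dM} {I : Type} (q : I -> Q) (m : I -> M) : M :=
  csup [set qact (q i) (m i) | i in [set: I]].

Section QComb.
Context {dQ dM dN : Order.disp_t} {Q : quantaleType dQ}.
Context {M : qmoduleType Q dM} {N : qmoduleType Q dN} {I : Type}.

Lemma qcomb_hom (m : I -> M) : qmodule_hom (qcomb ^~ m).
Proof.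
split=> [F|q f]; rewrite /qcomb.
- rewrite exchange_csup; congr csup; apply: eq_imagel => i _.
  by rewrite csup_funE qact_csupl image_comp.
- rewrite qact_csupr image_comp; congr csup; apply: eq_imagel => i _.
  by rewrite qact_funE qactM.
Qed.

Lemma qmodule_hom_qcomb {h : M -> N} (q : I -> Q) (m : I -> M) :
  qmodule_hom h -> h (qcomb q m) = qcomb q (h \o m).
Proof.
move=> [h_csup h_act]; rewrite h_csup image_comp; congr csup.
by apply: eq_imagel => i _ /=; rewrite h_act.
Qed.

Lemma qcomb_funE {Z : Type} (q : I -> Q) (f : I -> Z -> Q) (z : Z) :
  qcomb q f z = csup [set (q i * f i z)%g | i in [set: I]].
Proof. by rewrite /qcomb csup_funE image_comp. Qed.

End QComb.

Definition qdelta {d : Order.disp_t} (Q : quantaleType d) {X : Type} (x : X) :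
    X -> Q :=
  fun z => if `[< x = z >] then 1%g else csup set0.

Section FreeModule.
Context {dQ : Order.disp_t} {Q : quantaleType dQ} {X : Type}.

Lemma qcomb_qdelta (f : X -> Q) : qcomb f (qdelta Q) = f.
Proof.
apply/funext => z; rewrite qcomb_funE.
apply: csup_eq; split=> [_ [x _ <-]|u ubu].
- rewrite /qdelta; case: asboolP => [->|_]; first by rewrite mulg1.
  by rewrite qmul_csup0 csup0_le.
- by apply: ubu; exists z => //; rewrite /qdelta asboolT // mulg1.
Qed.

Lemma qmodule_hom_qdelta {dM : Order.disp_t} {M : qmoduleType Q dM}
    {h : (X -> Q) -> M} (f : X -> Q) :
  qmodule_hom h -> h f = qcomb f (h \o qdelta Q).
Proof. by move=> h_hom; rewrite -qmodule_hom_qcomb // qcomb_qdelta. Qed.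

Lemma qmodule_hom_lift {dP dN : Order.disp_t} {P : qmoduleType Q dP}
    {N : qmoduleType Q dN} {p : P -> N} {h : (X -> Q) -> N} :
  qmodule_hom p -> set_surj setT setT p -> qmodule_hom h ->
  exists2 g : (X -> Q) -> P, qmodule_hom g & h = p \o g.
Proof.
move=> p_hom p_surj h_hom.
have /choice[b pb] x : exists m : P, p m = h (qdelta Q x).
  by have [m _ pm] := p_surj (h (qdelta Q x)) I; exists m.
exists (qcomb ^~ b); first exact: qcomb_hom.
apply/funext => f /=; rewrite qmodule_hom_qdelta // qmodule_hom_qcomb //.
by congr qcomb; apply/funext => x /=; rewrite pb.
Qed.

Lemma kernel_mapE {Y : Type} (k : X * Y -> Q) (f : X -> Q) :
  kernel_map k f = qcomb f (fun x y => k (x, y)).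
Proof. by apply/funext => y; rewrite qcomb_funE. Qed.

Lemma qmodule_hom_kernel_map {Y : Type} {g : (X -> Q) -> Y -> Q} :
  qmodule_hom g -> g = kernel_map (fun xy => g (qdelta Q xy.1) xy.2).
Proof.
by move=> g_hom; apply/funext => f; rewrite kernel_mapE -qmodule_hom_qdelta.
Qed.

End FreeModule.

Theorem theorem5p20 (dQ dM dN : Order.disp_t) (Q : quantaleType dQ)
    (M : qmoduleType Q dM) (N : qmoduleType Q dN) (X Y : Type)
    (pi : (X -> Q) -> M) (pi' : (Y -> Q) -> N)
    (pi_hom : qmodule_hom pi) (pi_surj : set_surj setT setT pi)
    (pi'_hom : qmodule_hom pi') (pi'_surj : set_surj setT setT pi')
    (h : M -> N) (h_hom : qmodule_hom h) :
  exists k : X * Y -> Q, h \o pi = pi' \o kernel_map k.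
Proof.
have hpi_hom := qmodule_hom_comp pi_hom h_hom.
have [g g_hom ->] := qmodule_hom_lift pi'_hom pi'_surj hpi_hom.
exists (fun xy => g (qdelta Q xy.1) xy.2).
by rewrite -qmodule_hom_kernel_map.
Qed.
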